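(* Let $w\ge\sum_{i=1}^n\zeta_ix_i$ be the lifted-EPI associated with the natural order $(1,2,\dots,n)$ of $N$ and $S=[k]$. Then its coefficients are given by $$\zeta_j=\begin{cases}\rho_j,&\text{if }j\in[k-1],\\ \zeta_j^{[k-1]},&\text{if }j\in\mathcal{I}_L\setminus[k-1],\\ \min\left\{\zeta_{\mathcal{H}_{i-1}},\ \zeta_j^{\mathcal{H}(\min\{i-1,d_L\})\cup\mathcal{L}(d_L-i+1)\cup(\mathcal{I}_H\cap[k-1])}\right\},&\text{if }j=\mathcal{H}_i,\ i\in[d_H],\end{cases}$$ where, for $j=\mathcal{H}_1$, the symbol $\zeta_{\mathcal{H}_0}$ denotes $\zeta_j^{\mathcal{H}(0)\cup\mathcal{L}(d_L)\cup(\mathcal{I}_H\cap[k-1])}=\zeta_j^{[k-1]}$.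
   Context: $[j]=\{1,\dots,j\}$, $[0]=\emptyset$. $N=[n]$, $1\le k\le n$, and $f:\mathbb{R}\to\mathbb{R}$ is concave with $f(0)=0$. The weight vector $a\in\mathbb{R}^n_+$ has exactly two distinct values $0\le a_L<a_H$; $\mathcal{I}_L=\{i:a_i=a_L\}$, $\mathcal{I}_H=\{i:a_i=a_H\}$ (items may be in any order; the permutation used is the natural order $(1,\dots,n)$). EPI coefficients: $\rho_j=f(\sum_{i=1}^{j}a_i)-f(\sum_{i=1}^{j-1}a_i)$ for $j\in[k]$. Lifted-EPI: the inequality $w\ge\sum_{i=1}^n\zeta_ix_i$ obtained from the extended polymatroid inequality $w\ge\sum_{i=1}^k\rho_ix_i$ by exact sequential lifting in the order $k+1,\dots,n$; that is, $\zeta_j=\rho_j$ for $j\in[k]$, and for $j=k+1,\dots,n$ recursively $\zeta_j=\min\{\zeta_j^X: X\subseteq[j-1],\ |X|\le k-1\}$, where for $X\subseteq[j-1]$ with $|X|\le k-1$, $$\zeta_j^X=f\Big(a_j+\sum_{i\in X}a_i\Big)-\sum_{i\in X}\zeta_i .$$ Notation: $d_H=|\mathcal{I}_H\setminus[k-1]|$ and $d_L=|\mathcal{I}_L\cap[k-1]|$. $\mathcal{H}_1<\mathcal{H}_2<\dots<\mathcal{H}_{d_H}$ are the elements of $\mathcal{I}_H\setminus[k-1]$ in increasing order, and $\mathcal{L}_1<\dots<\mathcal{L}_{d_L}$ are the elements of $\mathcal{I}_L\cap[k-1]$ in increasing order. $\mathcal{H}(q)=\{\mathcal{H}_1,\dots,\mathcal{H}_q\}$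 for $q\in[d_H]$ and $\mathcal{L}(q)=\{\mathcal{L}_1,\dots,\mathcal{L}_q\}$ for $q\in[d_L]$; $\mathcal{H}(q)=\emptyset$ and $\mathcal{L}(q)=\emptyset$ when $q\le0$. *)

(* Defs.v *)
From mathcomp Require Import all_boot all_order all_algebra.
From mathcomp Require classical_sets.
From mathcomp Require Import reals interval_inference convex.

Set Implicit Arguments.
Unset Strict Implicit.
Unset Printing Implicit Defensive.

Import Order.TTheory GRing.Theory Num.Theory.
Local Open Scope ring_scope.

                                                                              
                                        

Definition concave_function (R : realType) (f : R -> R) : Prop :=
  @convex_function R R^o (@classical_sets.setT R^o) (fun x => - f x).

Lemma concave_functionP (R : realType) (f : R -> R) :
  concave_function f <->
  forall t x y : R, 0 <= t <= 1 ->
    t * f x + (1 - t) * f y <= f (t * x + (1 - t) * y).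
Proof.
have opp_avg (t u v : R) : - (t * - u + (1 - t) * - v) = t * u + (1 - t) * v.
  by rewrite !mulrN -opprD opprK.
split=> [cf t x y /andP[t0 t1]|cf t x y _ _].
  have := cf (Itv01 t0 t1) x y (classical_sets.mem_set I)
                               (classical_sets.mem_set I).
  by rewrite lerNl => /(le_trans _); apply; rewrite -opp_avg.
rewrite lerNl; apply: le_trans (cf t%:num x y _); last by rewrite ge0/= le1.
by rewrite -opp_avg.
Qed.

Definition initial (n m : nat) : {set 'I_n} := [set i : 'I_n | (i < m)%N].

Section LiftedEPI.
Variables (R : realType) (n : nat) (f : R -> R) (a : 'I_n -> R).

Definition rho (j : 'I_n) : R :=
  f (\sum_(i < n | (i <= j)%N) a i) - f (\sum_(i < n | (i < j)%N) a i).

Definition zetaX (zeta : 'I_n -> R) (j : 'I_n) (X : {set 'I_n}) : R :=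
  f (a j + \sum_(i in X) a i) - \sum_(i in X) zeta i.

                                                                            
                                                                        
Definition min_zetaX (k : nat) (zeta : 'I_n -> R) (j : 'I_n) : R :=
  \big[Num.min/zetaX zeta j set0]_(X : {set 'I_n}
      | (X \subset initial n j) && (#|X| <= k.-1)%N) zetaX zeta j X.

                                                                    
Fixpoint lifted_EPI_rec (k m : nat) (j : 'I_n) : R :=
  if (j < k)%N then rho j
  else if m is m'.+1 then min_zetaX k (lifted_EPI_rec k m') j else 0.

Definition lifted_EPI (k : nat) : 'I_n -> R := lifted_EPI_rec k n.

Lemma eq_min_zetaX k (z1 z2 : 'I_n -> R) (j : 'I_n) :
  (forall i : 'I_n, (i < j)%N -> z1 i = z2 i) ->
  min_zetaX k z1 j = min_zetaX k z2 j.
Proof.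
move=> ez.
have ezX (X : {set 'I_n}) :
    X \subset initial n j -> zetaX z1 j X = zetaX z2 j X.
  move=> /subsetP sX; congr (_ - _); apply: eq_bigr => i /sX.
  by rewrite inE => /ez.
rewrite /min_zetaX ezX ?sub0set//.
by apply: eq_bigr => X /andP[/ezX].
Qed.

Lemma lifted_EPI_rec_stable k m1 m2 (j : 'I_n) :
  (j < m1)%N -> (j < m2)%N -> lifted_EPI_rec k m1 j = lifted_EPI_rec k m2 j.
Proof.
elim: m1 m2 j => [//|m1 IH] [//|m2] j jm1 jm2 /=; case: ifP => // _.
by apply: eq_min_zetaX => i ij; apply: IH; apply: (leq_trans ij).
Qed.

Lemma lifted_EPIE k (j : 'I_n) :
  lifted_EPI k j = if (j < k)%N then rho j else min_zetaX k (lifted_EPI k) j.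
Proof.
have jn := ltn_ord j.
exact: (@lifted_EPI_rec_stable k n n.+1 j jn (leqW jn)).
Qed.

End LiftedEPI.

                                                                          
                                                                            
                                                                              
Definition item (n : nat) (x0 : 'I_n) (A : {set 'I_n}) (q : nat) : 'I_n :=
  nth x0 (enum A) q.-1.

Definition firsts (n : nat) (A : {set 'I_n}) (q : nat) : {set 'I_n} :=
  [set i in take q (enum A)].

Definition level (R : realType) (n : nat) (a : 'I_n -> R) (c : R) :
  {set 'I_n} := [set i | a i == c].

(* Main.v *)
Require Import Defs.
From mathcomp Require Import all_boot all_order all_algebra.
From mathcomp Require Import reals.
From mathcomp Require Import zify ring lra.

Set Implicit Arguments.
Unset Strict Implicit.
Unset Printing Implicit Defensive.

Import Order.TTheory GRing.Theory Num.Theory.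
Local Open Scope ring_scope.

(** Lifting coefficients are nonincreasing in the index among items of equal
    weight, because the minimum for the later item ranges over a larger family.
    Hence in the minimum defining a coefficient one may replace [X] by the
    first [p] light and the first [h] heavy items ([best p h]), whose value is
    [best_value c p h].  Let [dL] and [hO] count the light and heavy items among
    the first [k - 1].  By concavity of [f]:
    - if [p <= dL] and [h <= hO], adding the missing items of [[k - 1]] does not
      increase the value (the polymatroid argument);
    - if [p > dL] and [h < hO], neither does trading a light item for a heavy
      one;
    - if [h >= hO], neither does adding light items up to cardinality [k - 1].
    So only [[k - 1]] and the sets [best (k - 1 - h) h] with [h > hO] compete.
    For a light item the latter lose, by the upper bound that [best] gives on
    the coefficient of the last heavy item it contains; for a heavy item all of
    them but the largest were already available to the preceding heavy item. *)

(** * Ranks and increasing enumerations of sets of indices *)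

Section Rank.
Variable n : nat.
Implicit Types (A X : {set 'I_n}) (i j : 'I_n).

Lemma card_initial m : (m <= n)%N -> #|initial n m| = m.
Proof.
move=> mn; rewrite -sum1_card; under eq_bigl do rewrite inE.
by rewrite (big_ord_narrow mn) sum1_card card_ord.
Qed.

Lemma initialS i : initial n i.+1 = i |: initial n i.
Proof. by apply/setP => j; rewrite !inE ltnS leq_eqVlt -val_eqE. Qed.

Lemma initial_monotone m m' :
  (m <= m')%N -> initial n m \subset initial n m'.
Proof. by move=> mm'; apply/subsetP => i; rewrite !inE => /leq_trans; apply. Qed.

(** For [i] in [A], [rank A i] is the zero-based position of [i] in the increasing enumeration of
    [A]; [item] and [firsts] are then handled by comparing cardinalities. *)
Definition rank A m := #|A :&: initial n m|.

Lemma rank_card A m : (rank A m <= #|A|)%N.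
Proof. by rewrite subset_leq_card ?subsetIl. Qed.

Lemma rank_monotone A m m' : (m <= m')%N -> (rank A m <= rank A m')%N.
Proof. by move=> mm'; rewrite subset_leq_card ?setIS ?initial_monotone. Qed.

Lemma ltn_rank A i m : i \in A -> (rank A i < rank A m)%N = (i < m)%N.
Proof.
move=> iA; apply/idP/idP => [|im].
  by apply: contraLR; rewrite -!leqNgt => /rank_monotone; apply.
apply/proper_card/properP; split.
  by apply: setIS; apply: initial_monotone; apply: ltnW.
by exists i; rewrite !inE ?iA ?im ?ltnn.
Qed.

(** [enum A] filters the increasing list [enum 'I_n]; once it is split at [i], the indices below [i]
    are exactly those of the prefix. *)
Lemma index_enum_set A i : i \in A -> index i (enum A) = rank A i.
Proof.
move=> iA; have iE : i \in enum A by rewrite mem_enum.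
have : sorted ltn (map val (enum A)).
  have -> : enum A = [seq j <- enum 'I_n | j \in A] by rewrite enumT.
  rewrite sorted_map; apply: sorted_filter.
    by move=> ? ? ?; apply: ltn_trans.
  by rewrite -sorted_map val_enum_ord iota_ltn_sorted.
have : uniq (enum A) by exact: enum_uniq.
have : rank A i = count (fun j : 'I_n => j < i)%N (enum A).
  rewrite /rank cardE -size_filter; apply/perm_size.
  rewrite (perm_trans (enum_setI _ _))//.
  by rewrite (@eq_filter _ _ (fun j : 'I_n => j < i)%N) => // j; rewrite inE.
move=> ->; case/splitPr: iE => s t; rewrite cat_uniq map_cat /=.
move=> /and3P[_ /norP[nis _] _].
rewrite sorted_cat_cons index_cat (negPf nis) /= eqxx addn0 => /andP[ss tt].
rewrite count_cat /= ltnn add0n.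
have ltnT : transitive ltn by move=> ? ? ?; apply: ltn_trans.
rewrite (@eq_in_count _ _ predT) ?count_predT; last first.
  move=> j js; move: ss; rewrite -cats1 sorted_pairwise// pairwise_cat.
  by rewrite allrel1r => /andP[/allP /(_ _ (map_f val js))].
rewrite (@eq_in_count _ _ pred0) ?count_pred0 ?addn0// => j jt.
move: tt; rewrite path_sortedE// => /andP[/allP /(_ _ (map_f val jt)) /= lij _].
by rewrite ltnNge ltnW.
Qed.

Lemma in_firsts A q i : (i \in firsts A q) = (i \in A) && (rank A i < q)%N.
Proof.
rewrite inE; case: (boolP (i \in A)) => iA /=.
  by rewrite in_take ?mem_enum// index_enum_set.
by apply: contraNF iA => /mem_take; rewrite mem_enum.
Qed.

Lemma firsts_monotone A q q' : (q <= q')%N -> firsts A q \subset firsts A q'.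
Proof.
move=> qq'; apply/subsetP => i; rewrite !in_firsts => /andP[-> /=].
by move/leq_trans; apply.
Qed.

Lemma card_firsts A q : (q <= #|A|)%N -> #|firsts A q| = q.
Proof.
move=> qA; rewrite cardsE; have /card_uniqP -> : uniq (take q (enum A)).
  by rewrite take_uniq// enum_uniq.
by rewrite size_take_min -cardE; apply/minn_idPl.
Qed.

Lemma firstsS A i : i \in A -> firsts A (rank A i).+1 = i |: firsts A (rank A i).
Proof.
move=> iA; apply/setP => j; rewrite in_setU1 !in_firsts ltnS.
have [jA|jA] /= := boolP (j \in A); last first.
  by rewrite orbF; apply/esym; apply: contraNF jA => /eqP ->.
by rewrite ltn_rank// leqNgt ltn_rank// -leqNgt leq_eqVlt val_eqE.
Qed.

Lemma firsts_initial A m : firsts A (rank A m) = A :&: initial n m.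
Proof.
apply/setP => i; rewrite in_firsts !inE.
by case: (boolP (i \in A)) => //= iA; rewrite ltn_rank.
Qed.

Lemma firsts_sub_initial A q m :
  (q <= rank A m)%N -> firsts A q \subset initial n m.
Proof.
by move=> /firsts_monotone/subset_trans; apply; rewrite firsts_initial subsetIr.
Qed.

(** This and [firstsD] turn the sets of the statement, which are cut at [k.-1], into first elements
    of a whole weight level. *)
Lemma firstsI A m q :
  (q <= rank A m)%N -> firsts (A :&: initial n m) q = firsts A q.
Proof.
move=> qA; apply/setP => i; rewrite !in_firsts !inE -andbA.
case: (boolP (i \in A)) => //= iA; rewrite -(ltn_rank _ iA).
case: (ltnP (rank A i) (rank A m)) => /= [|mi]; last first.
  by apply/esym/negbTE; rewrite -leqNgt (leq_trans qA).
rewrite ltn_rank// => im; congr (_ < _)%N.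
by rewrite /rank -setIA (setIidPr (initial_monotone (ltnW im))).
Qed.

Lemma rankD A m i :
  (m <= i)%N -> rank A i = (rank A m + rank (A :\: initial n m) i)%N.
Proof.
move=> mi; rewrite /rank -[LHS](cardsID (initial n m)); congr (_ + _)%N.
  by rewrite -setIA (setIidPr (initial_monotone mi)).
by apply: eq_card => j; rewrite !inE andbA.
Qed.

Lemma firstsD A m q :
  firsts (A :\: initial n m) q :|: (A :&: initial n m) =
  firsts A (rank A m + q).
Proof.
apply/setP => i; rewrite in_setU !in_firsts !inE.
case: (boolP (i \in A)) => //= iA; rewrite ?andbF// andbT.
case: (ltnP i m) => /= [im|mi]; last by rewrite orbF (rankD A mi) ltn_add2l.
by apply/esym/ltn_addr; rewrite ltn_rank.
Qed.

Lemma rank_item A i0 q : (0 < q <= #|A|)%N ->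
  item i0 A q \in A /\ rank A (item i0 A q) = q.-1.
Proof.
case: q => // q /= qA; rewrite /item /=.
have qs : (q < size (enum A))%N by rewrite -cardE.
have iA : nth i0 (enum A) q \in A by rewrite -mem_enum mem_nth.
by split=> //; rewrite -index_enum_set// index_uniq ?enum_uniq.
Qed.

Lemma exists_rank A q : (q < #|A|)%N -> exists2 i, i \in A & rank A i = q.
Proof.
move=> qA; have /card_gt0P[i0 _] : (0 < #|A|)%N by apply: leq_ltn_trans qA.
by have [iA r] := @rank_item A i0 q.+1 qA; exists (item i0 A q.+1).
Qed.

(** Outside their intersection, [X] and [Y] have equally many elements. All those of [Y] come before
    the least one [j] of [X], so both sums compare with copies of [z j]. *)
Lemma ler_sum_firsts (R : numDomainType) (z : 'I_n -> R) A X :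
  {in A &, forall i j, (i <= j)%N -> z j <= z i} -> X \subset A ->
  \sum_(i in X) z i <= \sum_(i in firsts A #|X|) z i.
Proof.
move=> zA XA; set Y := firsts A #|X|.
have cY : #|Y| = #|X| by rewrite card_firsts// subset_leq_card.
rewrite (big_setID Y) (big_setID X (A := Y)) /= setIC lerD2l.
have cD : #|X :\: Y| = #|Y :\: X|.
  by apply/eqP; rewrite -(eqn_add2l #|X :&: Y|) cardsID setIC cardsID cY.
have [XY0|/set0Pn[i0 i0X]] := eqVneq (X :\: Y) set0.
  rewrite XY0 big_set0; have /eqP : #|Y :\: X| = 0%N by rewrite -cD XY0 cards0.
  by rewrite cards_eq0 => /eqP ->; rewrite big_set0.
pose j := [arg min_(i < i0 in X :\: Y) (i : nat)].
have [jX jmin] : j \in X :\: Y /\ {in X :\: Y, forall i, (j <= i)%N}.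
  by rewrite /j; case: arg_minnP.
have jA : j \in A by move: jX; rewrite inE => /andP[_] /(subsetP XA).
apply: (@le_trans _ _ (\sum_(i in X :\: Y) z j)).
  apply: ler_sum => i iX; apply: zA => //; last exact: jmin.
  by move: iX; rewrite inE => /andP[_] /(subsetP XA).
rewrite sumr_const cD -sumr_const; apply: ler_sum => i.
rewrite inE in_firsts => /andP[_ /andP[iA ri]]; apply: zA => //; apply/ltnW.
rewrite -(ltn_rank j iA); apply: leq_trans ri _; rewrite leqNgt.
by move: jX; rewrite inE in_firsts jA /= => /andP[].
Qed.

End Rank.

(** * Lifting coefficients for arbitrary nonnegative weights *)

Section Lifting.
Variables (R : realType) (n k : nat) (f : R -> R) (a : 'I_n -> R).
Hypotheses (hk : (1 <= k <= n)%N) (hf : concave_function f) (hf0 : f 0 = 0).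
Hypothesis a_ge0 : forall i, 0 <= a i.
Implicit Types (X : {set 'I_n}) (i j : 'I_n).

Local Notation z := (lifted_EPI f a k).
Local Notation K1 := (initial n k.-1).
Local Notation w X := (\sum_(i in X) a i).

(** [y] and [x + d] are convex combinations of [x] and [y + d] with exchanged coefficients; the two
    concavity inequalities are added. *)
Lemma concave_increment (x y d : R) :
  x <= y -> 0 <= d -> f (y + d) - f y <= f (x + d) - f x.
Proof.
move=> xy d0; move/concave_functionP : hf => cf.
have [D0|D0] := leP (y + d - x) 0.
  (* Setting this degenerate case aside makes the denominator of [t] positive. *)
  by have -> : y = x by lra.
set t := (y - x) / (y + d - x).
have t01 : 0 <= t <= 1.
  by apply/andP; split; rewrite /t ?ler_pdivrMr ?ler_pdivlMr//; lra.
have tD : t * (y + d - x) = y - x by rewrite divfK ?gt_eqF.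
have := cf t x (y + d) t01; have := cf t (y + d) x t01.
have -> : t * (y + d) + (1 - t) * x = y by lra.
have -> : t * x + (1 - t) * (y + d) = x + d by lra.
lra.
Qed.

Lemma sum_weights_ge0 X : 0 <= w X.
Proof. by apply: sumr_ge0. Qed.

Lemma ler_sum_weights (X Y : {set 'I_n}) : X \subset Y -> w X <= w Y.
Proof.
by move=> XY; rewrite [leRHS](big_setID X)/= (setIidPr XY) lerDl sum_weights_ge0.
Qed.

Lemma rhoE j : rho f a j = f (w (initial n j) + a j) - f (w (initial n j)).
Proof.
have -> : w (initial n j) + a j = w (initial n j.+1).
  by rewrite initialS big_setU1 ?inE ?ltnn//= addrC.
by rewrite /rho; congr (f _ - f _); apply: eq_bigl => i; rewrite inE.
Qed.

Lemma sum_rho m : (m <= n)%N ->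
  \sum_(i in initial n m) rho f a i = f (w (initial n m)).
Proof.
elim: m => [_|m IH mn].
  have -> : initial n 0 = set0 by apply/setP => i; rewrite !inE.
  by rewrite !big_set0 hf0.
have -> : initial n m.+1 = initial n (Ordinal mn).+1 by [].
rewrite initialS !big_setU1 ?inE ?ltnn//= IH 1?ltnW// rhoE/=.
by rewrite subrK addrC.
Qed.

(** The missing items are inserted in increasing order. When [i] enters, the argument of [f] is
    already at least the weight of all items before [i], so by concavity [f] gains at most
    [rho f a i]. *)
Lemma rho_saturate m X c : (m <= n)%N -> X \subset initial n m -> 0 <= c ->
  f (c + w (initial n m)) - \sum_(i in initial n m) rho f a i <=
  f (c + w X) - \sum_(i in X) rho f a i.
Proof.
move=> mn Xm c0.
suff H s : (s <= n)%N -> f (c + w (X :|: initial n s)) -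
    \sum_(i in X :|: initial n s) rho f a i <= f (c + w X) - \sum_(i in X) rho f a i.
  by have := H m mn; rewrite (setUidPr Xm).
elim: s => [_|s IH sn].
  have -> : initial n 0 = set0 by apply/setP => i; rewrite !inE.
  by rewrite setU0.
apply: le_trans (IH (ltnW sn)); pose i := Ordinal sn.
have -> : initial n s.+1 = i |: initial n s by rewrite -initialS.
rewrite setUCA; have [iX|iX] := boolP (i \in X :|: initial n s).
  by rewrite (setUidPr _)// sub1set.
rewrite !big_setU1//= rhoE.
have := @concave_increment (w (initial n i)) (c + w (X :|: initial n s)) (a i).
rewrite a_ge0 => /(_ _ isT); rewrite (addrCA c) (addrC (a i)).
have -> : w (initial n i) <= c + w (X :|: initial n s).
  by rewrite -[leLHS]add0r lerD// ler_sum_weights// subsetUr.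
move=> /(_ isT); rewrite /=; lra.
Qed.

Lemma lifted_rho j : (j < k)%N -> z j = rho f a j.
Proof. by move=> jk; rewrite lifted_EPIE jk. Qed.

Lemma sum_lifted_rho X : X \subset initial n k ->
  \sum_(i in X) z i = \sum_(i in X) rho f a i.
Proof.
by move=> /subsetP XK; apply: eq_bigr => i /XK; rewrite inE => /lifted_rho.
Qed.

Lemma sum_lifted_init : \sum_(i in K1) z i = f (w K1).
Proof.
rewrite sum_lifted_rho ?sum_rho ?initial_monotone ?leq_pred//.
by move: hk; lia.
Qed.

Lemma last_rho j : j = k.-1 :> nat -> z j = f (a j + w K1) - f (w K1).
Proof.
move=> jk; rewrite lifted_rho; last by move: hk; lia.
by rewrite rhoE jk (addrC (a j)).
Qed.

(** The item of zero-based index [k.-1] has coefficient [rho], but by [rho_saturate] this is also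
    the minimum, attained at [[k-1]]. Together with [lifted_ge] this treats all indices from [k.-1]
    on alike. *)
Lemma lifted_le j X : (k.-1 <= j)%N -> X \subset initial n j ->
  (#|X| <= k.-1)%N -> z j <= zetaX f a z j X.
Proof.
move=> kj Xj Xk; have [kj'|jk] := leqP k j.
  by rewrite lifted_EPIE ltnNge kj' /= /min_zetaX bigmin_le_cond ?Xj.
have jE : j = k.-1 :> nat by apply/eqP; rewrite eqn_leq kj andbT; lia.
rewrite last_rho// -sum_lifted_init /zetaX.
rewrite !sum_lifted_rho ?initial_monotone ?leq_pred//; last first.
  by apply: subset_trans Xj _; rewrite initial_monotone// ltnW.
apply: rho_saturate => //; last by rewrite -jE.
by move: hk; lia.
Qed.

Lemma lifted_ge j b : (k.-1 <= j)%N ->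
  (forall X, X \subset initial n j -> (#|X| <= k.-1)%N -> b <= zetaX f a z j X) ->
  b <= z j.
Proof.
move=> kj H; have [kj'|jk] := leqP k j.
  rewrite lifted_EPIE ltnNge kj' /= /min_zetaX; apply/bigmin_geP; split.
    by apply: H; rewrite ?sub0set ?cards0.
  by move=> X /andP[]; apply: H.
have jE : j = k.-1 :> nat by apply/eqP; rewrite eqn_leq kj andbT; lia.
rewrite last_rho// -sum_lifted_init; apply: H; first by rewrite -jE.
by rewrite card_initial// -jE ltnW.
Qed.

Lemma lifted_le_initial j : (k.-1 <= j)%N -> z j <= f (w K1 + a j) - f (w K1).
Proof.
move=> kj; rewrite -sum_lifted_init [w K1 + _]addrC; apply: lifted_le => //.
  exact: initial_monotone.
by rewrite card_initial//; move: hk; lia.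
Qed.

(** If [i] comes before [k.-1], concavity replaces the inclusion of families; an index [j] from
    [k.-1] on then enters through its candidate [[k-1]]. *)
Lemma lifted_monotone i j : a i = a j -> (i <= j)%N -> z j <= z i.
Proof.
move=> aij ij; have [ki|ik] := leqP k.-1 i.
  apply: lifted_ge => // X Xi Xk.
  have -> : zetaX f a z i X = zetaX f a z j X by rewrite /zetaX aij.
  apply: lifted_le => //; first exact: leq_trans ij.
  by apply: subset_trans Xi _; apply: initial_monotone.
have iK : (i < k)%N by lia.
rewrite [leRHS]lifted_rho// rhoE.
have [kj|jk] := leqP k.-1 j.
  apply: le_trans (lifted_le_initial kj) _; rewrite aij.
  by apply: concave_increment => //; rewrite ler_sum_weights// initial_monotone// ltnW.
rewrite lifted_rho ?rhoE ?aij; last by lia.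
by apply: concave_increment => //; rewrite ler_sum_weights// initial_monotone.
Qed.

End Lifting.

(** * Two weight levels: candidate sets reduced to their numbers of light and heavy items *)

Section TwoLevels.
Variables (R : realType) (n k : nat) (f : R -> R) (a : 'I_n -> R) (aL aH : R).
Hypotheses (hk : (1 <= k <= n)%N) (hf : concave_function f) (hf0 : f 0 = 0).
Hypotheses (haL : 0 <= aL) (haLH : aL < aH).
Hypothesis ha : forall i, a i = aL \/ a i = aH.
Implicit Types (X : {set 'I_n}) (i j : 'I_n) (c : R) (p h : nat).

Local Notation z := (lifted_EPI f a k).
Local Notation K1 := (initial n k.-1).
Local Notation IL := (level a aL).
Local Notation IH := (level a aH).
Local Notation dL := (rank IL k.-1).
Local Notation hO := (rank IH k.-1).

Lemma heavy_ge0 : 0 <= aH.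
Proof. exact: le_trans haL (ltW haLH). Qed.

Lemma weights_ge0 i : 0 <= a i.
Proof. by case: (ha i) => ->//; apply: heavy_ge0. Qed.

Lemma levelD X : X :\: IL = X :&: IH.
Proof.
apply/setP => i; rewrite !inE andbC; case: (i \in X) => //=.
by case: (ha i) => ->; rewrite eqxx ?(lt_eqF haLH) ?(gt_eqF haLH).
Qed.

Lemma sum_levels (F : 'I_n -> R) X :
  \sum_(i in X) F i = \sum_(i in X :&: IL) F i + \sum_(i in X :&: IH) F i.
Proof. by rewrite (big_setID IL)/= levelD. Qed.

Lemma card_levels X : #|X| = (#|X :&: IL| + #|X :&: IH|)%N.
Proof. by rewrite -(cardsID IL X) levelD. Qed.

Lemma sum_weights X :
  \sum_(i in X) a i = #|X :&: IL|%:R * aL + #|X :&: IH|%:R * aH.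
Proof.
have H c : \sum_(i in X :&: level a c) a i = #|X :&: level a c|%:R * c.
  rewrite mulr_natl -sumr_const; apply: eq_bigr => i.
  by rewrite !inE => /andP[_ /eqP].
by rewrite sum_levels !H.
Qed.

Lemma rank_levels m : (m <= n)%N -> (rank IL m + rank IH m)%N = m.
Proof.
by move=> mn; rewrite /rank !(setIC _ (initial n m)) -card_levels card_initial.
Qed.

Lemma initial_levels : (dL + hO)%N = k.-1.
Proof. by rewrite rank_levels//; move: hk; lia. Qed.

Definition best p h := firsts IL p :|: firsts IH h.

(** [c] stands for the weight of the item being lifted. The counts appear as numbers, so that adding
    an item is an algebraic change; agreement with [zetaX] is shown when neither count exceeds the
    size of its level. *)
Definition best_value c p h := f (c + p%:R * aL + h%:R * aH)
  - \sum_(i in firsts IL p) z i - \sum_(i in firsts IH h) z i.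

Lemma bestI p h : (best p h :&: IL = firsts IL p) * (best p h :&: IH = firsts IH h).
Proof.
split; apply/setP => i; rewrite in_setI in_setU !in_firsts !inE;
  by case: (ha i) => ->; rewrite ?eqxx ?(lt_eqF haLH) ?(gt_eqF haLH)/= ?andbF ?orbF ?andbT.
Qed.

Lemma card_best p h : (p <= #|IL|)%N -> (h <= #|IH|)%N -> #|best p h| = (p + h)%N.
Proof. by move=> pL hH; rewrite card_levels !bestI !card_firsts. Qed.

Lemma best_valueE c p h : (p <= #|IL|)%N -> (h <= #|IH|)%N ->
  f (c + \sum_(i in best p h) a i) - \sum_(i in best p h) z i = best_value c p h.
Proof.
move=> pL hH; rewrite sum_weights (sum_levels z) !bestI !card_firsts//.
by rewrite /best_value opprD !addrA.
Qed.

Lemma zetaX_best j p h : (p <= #|IL|)%N -> (h <= #|IH|)%N ->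
  zetaX f a z j (best p h) = best_value (a j) p h.
Proof. exact: best_valueE. Qed.

Lemma best_initial : best dL hO = K1.
Proof. by rewrite /best !firsts_initial !(setIC _ K1) -levelD setID. Qed.

Lemma best_sub m p h :
  (p <= rank IL m)%N -> (h <= rank IH m)%N -> best p h \subset initial n m.
Proof. by move=> pm hm; rewrite subUset !firsts_sub_initial. Qed.

(** The argument of [f] depends on [X] only through its two counts, while the subtracted sum is
    largest on the earliest items of each level. *)
Lemma best_value_le j X :
  best_value (a j) #|X :&: IL| #|X :&: IH| <= zetaX f a z j X.
Proof.
have H c : \sum_(i in X :&: level a c) z i <=
    \sum_(i in firsts (level a c) #|X :&: level a c|) z i.
  apply: ler_sum_firsts (subsetIr _ _) => i1 i2; rewrite !inE => /eqP e1 /eqP e2.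
  by apply: lifted_monotone => //; [exact: weights_ge0|rewrite e1 e2].
rewrite /zetaX /best_value sum_weights (sum_levels z X) addrA.
by have := H aL; have := H aH; lra.
Qed.

Lemma rho_increment j x : (j < k.-1)%N ->
  (rank IL j)%:R * aL + (rank IH j)%:R * aH <= x -> f (x + a j) - f x <= z j.
Proof.
move=> jk Bx; rewrite lifted_rho ?rhoE; last by lia.
apply: concave_increment => //; last exact: weights_ge0.
by rewrite sum_weights -!(setIC _ (initial n j)).
Qed.

Lemma ler_natM m m' c : 0 <= c -> (m <= m')%N -> m%:R * c <= m'%:R * c.
Proof. by move=> c0 mm'; rewrite ler_wpM2r ?ler_nat. Qed.

Lemma best_valueSl c p h i : i \in IL -> rank IL i = p ->
  best_value c p.+1 h = f (c + p%:R * aL + h%:R * aH + aL) - z i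
  - \sum_(i in firsts IL p) z i - \sum_(i in firsts IH h) z i.
Proof.
move=> iL <-; rewrite /best_value firstsS// big_setU1 ?in_firsts ?ltnn ?andbF//=.
by rewrite -natr1 opprD addrA; congr (f _ - _ - _ - _); ring.
Qed.

Lemma best_valueSr c p h i : i \in IH -> rank IH i = h ->
  best_value c p h.+1 = f (c + p%:R * aL + h%:R * aH + aH) - z i
  - \sum_(i in firsts IL p) z i - \sum_(i in firsts IH h) z i.
Proof.
move=> iL <-; rewrite /best_value firstsS// big_setU1 ?in_firsts ?ltnn ?andbF//=.
have -> : c + p%:R * aL + (rank IH i).+1%:R * aH =
  c + p%:R * aL + (rank IH i)%:R * aH + aH by rewrite -natr1; ring.
by ring.
Qed.

(** The heavy items before [i] number at most [hO]; this coarser base weight suits sets holding at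
    least [hO] heavy items. *)
Lemma low_rho i x : i \in IL -> (i < k.-1)%N ->
  (rank IL i)%:R * aL + hO%:R * aH <= x -> f (x + aL) - f x <= z i.
Proof.
move=> iL ik ix; have <- : a i = aL by move: iL; rewrite inE => /eqP.
apply: rho_increment => //; apply: le_trans ix; rewrite lerD2l.
by rewrite ler_natM ?heavy_ge0// rank_monotone// ltnW.
Qed.

Lemma high_rho i x : i \in IH -> (i < k.-1)%N ->
  dL%:R * aL + (rank IH i)%:R * aH <= x -> f (x + aH) - f x <= z i.
Proof.
move=> iH ik ix; have <- : a i = aH by move: iH; rewrite inE => /eqP.
apply: rho_increment => //; apply: le_trans ix; rewrite lerD2r.
by rewrite ler_natM// rank_monotone// ltnW.
Qed.

Lemma best_value_initial c :
  best_value c dL hO = f (c + (dL%:R * aL + hO%:R * aH)) - f (dL%:R * aL + hO%:R * aH).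
Proof.
have <- : \sum_(i in K1) a i = dL%:R * aL + hO%:R * aH.
  by rewrite sum_weights -!(setIC _ K1).
by rewrite -best_valueE ?rank_card// best_initial sum_lifted_init.
Qed.

(** * Comparison of candidate values by concavity *)

Lemma saturate c p h : 0 <= c -> (p <= dL)%N -> (h <= hO)%N ->
  best_value c dL hO <= best_value c p h.
Proof.
move=> c0 pd hh; have pL := leq_trans pd (rank_card IL _).
have hH := leq_trans hh (rank_card IH _).
rewrite -!best_valueE ?rank_card// best_initial.
have sub : best p h \subset K1 by exact: best_sub.
have K1K : K1 \subset initial n k by rewrite initial_monotone// leq_pred.
rewrite !sum_lifted_rho//; last exact: subset_trans sub K1K.
apply: rho_saturate => //; first exact: weights_ge0.
by move: hk; lia.
Qed.

(** While [p + h < k.-1], the bound [hO <= h] forces [p < dL], so the next light item lies in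
    [[k-1]] and [low_rho] bounds the gain of [f] by its coefficient. *)
Lemma fill_lows c p h : 0 <= c -> (hO <= h)%N -> (p + h <= k.-1)%N ->
  best_value c (k.-1 - h) h <= best_value c p h.
Proof.
move=> c0 hh; move e : (k.-1 - h - p)%N => d.
elim: d p e => [|d IH] p e ph.
  by have -> : p = (k.-1 - h)%N by lia.
apply: le_trans (IH p.+1 _ _) _; [by lia|by lia|].
have pd : (p < dL)%N by have := initial_levels; lia.
have [i iL ri] := exists_rank (leq_trans pd (rank_card IL _)).
rewrite (best_valueSl _ _ iL ri) /best_value.
have := @low_rho i (c + p%:R * aL + h%:R * aH) iL.
rewrite -(ltn_rank _ iL) ri => /(_ pd).
have : hO%:R * aH <= h%:R * aH by rewrite ler_natM ?heavy_ge0.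
move=> hhh /(_ ltac:(lra)); lra.
Qed.

(** Both sides are compared with the value for [p] light and [h] heavy items: adding the heavy item
    does not raise it, and adding the light one does not lower it. *)
Lemma swap_low_high c p h : 0 <= c <= aH -> (dL <= p < #|IL|)%N -> (h < hO)%N ->
  (p + h < k.-1)%N -> best_value c p h.+1 <= best_value c p.+1 h.
Proof.
move=> /andP[c0 cH] /andP[dp pL] hh ph.
have [l lL rl] := exists_rank pL.
have [i iH ri] := exists_rank (leq_trans hh (rank_card IH _)).
rewrite (best_valueSl _ _ lL rl) (best_valueSr _ _ iH ri).
set y := c + p%:R * aL + h%:R * aH.
have hi : f (y + aH) - f y <= z i.
  apply: high_rho => //; first by rewrite -(ltn_rank _ iH) ri.
  rewrite ri /y; have := ler_natM haL dp; lra.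
have kl : (k.-1 <= l)%N by rewrite leqNgt -(ltn_rank _ lL) rl -leqNgt.
have al : a l = aL by move: lL; rewrite inE => /eqP.
have := lifted_le_initial hk hf hf0 weights_ge0 kl.
rewrite sum_weights -!(setIC _ K1) -/(rank IL k.-1) -/(rank IH k.-1) al.
set A := (_ * aL + _ * aH) => zl.
(* One of the missing heavy items outweighs [c], and the other [hO - h.+1] outweigh the [p - dL]
   surplus light ones. *)
have yA : y <= A.
  have : ((p + h).+1 <= dL + hO)%N by rewrite initial_levels.
  move=> ph1; rewrite /y /A.
  have -> : dL%:R = p%:R - (p - dL)%:R :> R by rewrite natrB//; ring.
  have -> : hO%:R = h%:R + 1 + (hO - h.+1)%:R :> R by rewrite natrB// -natr1; ring.
  have : (p - dL)%:R * aL <= (hO - h.+1)%:R * aL by rewrite ler_natM//; lia.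
  have : (hO - h.+1)%:R * aL <= (hO - h.+1)%:R * aH.
    by rewrite ler_wpM2l// ltW.
  lra.
have := concave_increment hf yA haL; lra.
Qed.

(* Removing light items in favour of heavy ones until [p <= dL] reduces to
   [saturate]: if [p > dL] then [p + h <= dL + hO] forces [h < hO]. *)
Lemma best_value_few_highs c p h : 0 <= c <= aH -> (p <= #|IL|)%N ->
  (h <= hO)%N -> (p + h <= k.-1)%N -> best_value c dL hO <= best_value c p h.
Proof.
move=> cc; have /andP[c0 _] := cc; elim: p h => [|p IH] h pL hh ph.
  exact: saturate.
have [pd|dp] := leqP p.+1 dL; first exact: saturate.
have hlt : (h < hO)%N by have := initial_levels; lia.
apply: le_trans (IH h.+1 _ _ _) _ => //; [exact: ltnW|by lia|].
by apply: swap_low_high => //; rewrite -ltnS dp.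
Qed.

(** * Coefficients of light and heavy items from index [k.-1] on *)

Lemma feasible_bounds j X : X \subset initial n j -> (#|X| <= k.-1)%N ->
  [/\ (#|X :&: IL| <= #|IL|)%N, (#|X :&: IH| <= rank IH j)%N
    & (#|X :&: IL| + #|X :&: IH| <= k.-1)%N].
Proof.
move=> Xj Xk; rewrite -card_levels; split => //.
  by rewrite subset_leq_card// subsetIr.
by rewrite setIC subset_leq_card// setIS.
Qed.

Lemma lifted_le_best j p h : (k.-1 <= j)%N -> (p <= dL)%N ->
  (h <= rank IH j)%N -> (p + h <= k.-1)%N -> z j <= best_value (a j) p h.
Proof.
move=> kj pd hh ph; have pL := leq_trans pd (rank_card IL _).
have hH := leq_trans hh (rank_card IH _).
rewrite -zetaX_best//; apply: lifted_le => //; first exact: weights_ge0.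
  by apply: best_sub => //; apply: leq_trans pd (rank_monotone IL kj).
by rewrite card_best.
Qed.

Lemma zetaX_initial j : zetaX f a z j K1 = best_value (a j) dL hO.
Proof. by rewrite -best_initial zetaX_best ?rank_card. Qed.

Lemma lifted_low j : j \in IL -> (k.-1 <= j)%N -> z j = zetaX f a z j K1.
Proof.
rewrite inE => /eqP aj kj; apply/eqP; rewrite eq_le zetaX_initial.
rewrite lifted_le_best ?rank_monotone ?initial_levels//=.
apply: lifted_ge => // X Xj Xk.
have [pL hH ph] := feasible_bounds Xj Xk.
apply: le_trans (best_value_le j X); rewrite aj.
move: #|X :&: IL| #|X :&: IH| pL hH ph => p h pL hH ph.
have [hh|hh] := leqP h hO.
  by apply: best_value_few_highs => //; rewrite haL ltW.
apply: le_trans (fill_lows haL (ltnW hh) ph).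
case: h hH ph hh => // h hH ph hh.
have pd : (k.-1 - h.+1 < dL)%N by have := initial_levels; lia.
have [i iH ri] : exists2 i, i \in IH & rank IH i = h.
  by apply: exists_rank; apply: leq_trans hH (rank_card IH _).
have [l lL rl] := exists_rank (leq_trans pd (rank_card IL _)).
have ki : (k.-1 <= i)%N by rewrite leqNgt -(ltn_rank _ iH) ri -leqNgt.
have ai : a i = aH by move: iH; rewrite inE => /eqP.
(* This candidate for the last heavy item [i] contains the extra light item [l]. Its total weight
   together with [i] equals that of the competing set together with [j], so the [f] terms cancel and
   [z l] remains. *)
have := @lifted_le_best i (k.-1 - h.+1).+1 h ki pd.
rewrite ri ai leqnn => /(_ isT ltac:(lia)).
rewrite (best_valueSl _ _ lL rl) (best_valueSr _ _ iH ri) best_value_initial.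
(* The increment of [f] at the weight of [[k-1]], which is the value to be beaten, is at most
   [z l]. *)
have := @low_rho l (dL%:R * aL + hO%:R * aH) lL.
rewrite -(ltn_rank _ lL) rl => /(_ pd).
have -> : (k.-1 - h.+1)%:R * aL + hO%:R * aH <= dL%:R * aL + hO%:R * aH.
  by rewrite lerD2r ler_natM// ltnW.
move=> /(_ isT); rewrite (addrC aL).
set x := (k.-1 - h.+1)%:R * aL; set y := h%:R * aH.
have -> : aH + x + y + aL = aL + x + y + aH by ring.
lra.
Qed.

(** Only [hO] heavy items precede [j], so [best_value_few_highs] covers every candidate. *)
Lemma lifted_first_high j : j \in IH -> rank IH j = hO -> (k.-1 <= j)%N ->
  z j = zetaX f a z j K1.
Proof.
rewrite inE => /eqP aj rj kj; apply/eqP; rewrite eq_le zetaX_initial.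
rewrite lifted_le_best ?rj ?initial_levels//=.
apply: lifted_ge => // X Xj Xk.
have [pL hH ph] := feasible_bounds Xj Xk.
apply: le_trans (best_value_le j X); rewrite aj.
by apply: best_value_few_highs => //; rewrite ?heavy_ge0 ?lexx -?rj.
Qed.

Lemma lifted_next_high j j' q : j \in IH -> j' \in IH -> (0 < q)%N ->
  rank IH j = (hO + q)%N -> rank IH j' = (hO + q.-1)%N ->
  z j = Num.min (z j') (zetaX f a z j (best (dL - q) (hO + minn q dL))).
Proof.
move=> jH j'H q0 rj rj'.
have aj : a j = aH by move: jH; rewrite inE => /eqP.
have aj' : a j' = aH by move: j'H; rewrite inE => /eqP.
have kj : (k.-1 <= j)%N by rewrite leqNgt -(ltn_rank _ jH) rj -leqNgt leq_addr.
have kj' : (k.-1 <= j')%N by rewrite leqNgt -(ltn_rank _ j'H) rj' -leqNgt leq_addr.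
have lej p h := @lifted_le_best j p h kj; rewrite aj rj in lej.
have lej' p h := @lifted_le_best j' p h kj'; rewrite aj' rj' in lej'.
have dk := initial_levels; have rn := rank_card IH j; have dn := rank_card IL k.-1.
rewrite zetaX_best ?aj; try by lia.
apply/eqP; rewrite eq_le; apply/andP; split.
  rewrite le_min; apply/andP; split.
    apply: lifted_monotone => //; first exact: weights_ge0.
      by rewrite aj aj'.
    by apply: ltnW; rewrite -(ltn_rank _ j'H) rj rj'; lia.
  by apply: lej; lia.
apply: lifted_ge => // X Xj Xk.
have [pL hH ph] := feasible_bounds Xj Xk.
apply: le_trans (best_value_le j X); rewrite aj ge_min.
move: #|X :&: IL| #|X :&: IH| pL hH ph => p h pL; rewrite rj => hH ph.
have [hh|hh] := leqP h hO.
  apply/orP; left; apply: le_trans (best_value_few_highs _ pL hh ph).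
    by apply: lej'; lia.
  by rewrite heavy_ge0 lexx.
have fl := fill_lows heavy_ge0 (ltnW hh) ph.
(* With fewer than [hO + q] heavy items the set is available to [j']. Otherwise [h = hO + q], and
   the bound on the cardinality gives [q <= dL], so [minn q dL] is [q]. *)
have [hq|hq] := ltnP h (hO + q); apply/orP; [left|right]; apply: le_trans fl.
  by apply: lej'; lia.
have -> : (k.-1 - h = dL - q)%N by lia.
by have -> : (hO + minn q dL = h)%N by lia.
Qed.

End TwoLevels.

Theorem proposition3p6 (R : realType) (n k : nat) (f : R -> R)
    (a : 'I_n -> R) (aL aH : R)
    (hk : (1 <= k <= n)%N)
    (hf : concave_function f) (hf0 : f 0 = 0)
    (haL : 0 <= aL) (haLH : aL < aH)
    (ha : forall i, a i = aL \/ a i = aH)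
    (hL : exists i, a i = aL) (hH : exists i, a i = aH) :
  let K1 := initial n k.-1 in
  let IL := level a aL in
  let IH := level a aH in
  let HS := IH :\: K1 in
  let LS := IL :&: K1 in
  let dH := #|HS| in
  let dL := #|LS| in
  let zeta := lifted_EPI f a k in
  [/\ forall j, j \in K1 -> zeta j = rho f a j,
      forall j, j \in IL :\: K1 -> zeta j = zetaX f a zeta j K1
    & forall (i : nat) (j : 'I_n), (1 <= i <= dH)%N -> j = item j HS i ->
      let zeta_H0 :=
        zetaX f a zeta j (firsts HS 0 :|: firsts LS dL :|: (IH :&: K1)) in
      (i = 1%N -> zeta_H0 = zetaX f a zeta j K1) /\
      zeta j =
        Num.min (if i == 1%N then zeta_H0 else zeta (item j HS i.-1))
          (zetaX f a zeta j
             (firsts HS (minn i.-1 dL) :|: firsts LS (dL + 1 - i)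
                :|: (IH :&: K1)))].
Proof.
move=> K1 IL IH HS LS dH dL zeta.
(* The heavy items of [[k-1]] and the first [q] heavy items after them are the first heavy items
   overall; [p <= dL] keeps the light ones inside [[k-1]]. *)
have bestE q p : (p <= dL)%N ->
    firsts HS q :|: firsts LS p :|: (IH :&: K1) =
      best a aL aH p (rank IH k.-1 + q).
  by move=> pd; rewrite setUAC setUC firstsI// firstsD.
have best0 : firsts HS 0 :|: firsts LS dL :|: (IH :&: K1) = K1.
  by rewrite bestE// addn0 best_initial.
split=> [j|j|i j iH jE].
- by rewrite inE => jk; apply: lifted_rho; lia.
- rewrite !inE -leqNgt => /andP[kj aj].
  by apply: (lifted_low (aL := aL) (aH := aH)) => //; rewrite inE.
rewrite best0 => zeta_H0; split=> //.
have [jHS rj] := rank_item j iH; rewrite -jE in jHS rj.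
move: (jHS); rewrite !inE -leqNgt => /andP[kj aj].
have jH : j \in IH by rewrite inE.
have rjH : rank IH j = (rank IH k.-1 + i.-1)%N by rewrite (rankD IH kj) rj.
have [i1|i1] := eqVneq i 1%N.
  (* For [i = 1] both arguments of the minimum are the value at [[k-1]]. *)
  rewrite i1 /= min0n addn1 subn1 best0 minxx.
  by apply: (lifted_first_high (aL := aL) (aH := aH)) => //; rewrite rjH i1 addn0.
have i'H : (0 < i.-1 <= dH)%N by lia.
have [j'HS rj'] := rank_item j i'H.
move: (j'HS); rewrite !inE -leqNgt => /andP[kj' aj'].
(* Subtraction truncated at 0 encodes the convention that the light part is empty for a nonpositive
   count. *)
have -> : (dL + 1 - i = dL - i.-1)%N by lia.
rewrite bestE ?leq_subr//=; have j'H : item j HS i.-1 \in IH by rewrite inE.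
apply: (lifted_next_high hk hf hf0 haL haLH ha jH j'H _ rjH) => //; first by lia.
by rewrite -/IH (rankD IH kj') rj'.
Qed.
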